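(* Let $\{(\mathcal{W}_i,v_i)\}_{i\in I}$ be a fusion frame for a Hilbert space $\mathcal{H}$ such that $\{(\mathcal{W}_i^\perp,v_i)\}_{i\in I}$ is also a fusion frame for $\mathcal{H}$. Then the following hold. (i) Let $S$ denote the fusion frame operator of $\{(\mathcal{W}_i,v_i)\}_{i\in I}$, with eigenvectors $\{e_j\}_{j\in J}$ and respective eigenvalues $\{\lambda_j\}_{j\in J}$. Then the fusion frame operator of $\{(\mathcal{W}_i^\perp,v_i)\}_{i\in I}$ possesses the same eigenvectors $\{e_j\}_{j\in J}$ with respective eigenvalues $\{\sum_{i\in I}v_i^2-\lambda_j\}_{j\in J}$. (ii) Assume that $\dim\mathcal{H}<\infty$ and $m:=\dim\mathcal{W}_i$ for all $i\in I$. Then $$d_c^2(\mathcal{W}_i^\perp,\mathcal{W}_j^\perp)=d_c^2(\mathcal{W}_i,\mathcal{W}_j)+2m-\dim\mathcal{H}\quad\text{for all } i,j\in I,\ i\neq j.$$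
   Context: For a Hilbert space $\mathcal{H}$, a family of closed subspaces $\{\mathcal{W}_i\}_{i\in I}$ with positive weights $v_i$ is a fusion frame for $\mathcal{H}$, written $\{(\mathcal{W}_i,v_i)\}_{i\in I}$, if there are constants $0<A\le B<\infty$ with $A\|f\|^2\le\sum_{i\in I}v_i^2\|P_if\|^2\le B\|f\|^2$ for all $f\in\mathcal{H}$, where $P_i$ is the orthogonal projection onto $\mathcal{W}_i$. Its fusion frame operator is $Sf=\sum_{i\in I}v_i^2P_if$. When $\{(\mathcal{W}_i^\perp,v_i)\}_{i\in I}$ is also a fusion frame, it is called the orthogonal fusion frame to $\{(\mathcal{W}_i,v_i)\}_{i\in I}$. For subspaces $\mathcal{V},\mathcal{W}$ of a finite-dimensional Hilbert space $\mathcal{H}$ with orthogonal projections $P_{\mathcal{V}},P_{\mathcal{W}}$, the squared chordal distance is defined (in this paper) as $d_c^2(\mathcal{V},\mathcal{W})=\dim\mathcal{H}-\mathrm{tr}[P_{\mathcal{V}}P_{\mathcal{W}}]$. *)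

(* Defs.v *)
From HB Require Import structures.
From mathcomp Require Import all_boot all_order all_algebra sesquilinear.
From mathcomp Require Import finmap complex.
From mathcomp Require Import all_classical all_reals all_analysis.
From mathcomp Require Import summability.

Set Implicit Arguments.
Unset Strict Implicit.
Unset Printing Implicit Defensive.

Import Order.TTheory GRing.Theory Num.Theory.
Import numFieldNormedType.Exports.

Local Open Scope classical_set_scope.
Local Open Scope ring_scope.

(* Scalars are R or R[i].  Over both, norms take values in the scalar field
   itself, and [0 < a] (or [a <= b] with one side real) in a numFieldType
   forces the elements involved to be real: this is how real weights and real
   frame bounds are expressed below. *)
Variant scalar_kind := RealScalars | ComplexScalars.

Definition scalar_field (R : realType) (k : scalar_kind) : numFieldType :=
  match k with RealScalars => R | ComplexScalars => R[i] end.

Definition scalar_conj (R : realType) (k : scalar_kind) :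
    {rmorphism scalar_field R k -> scalar_field R k} :=
  match k with RealScalars => idfun | ComplexScalars => Num.conj end.

(* Inner products are linear in the first and conjugate-linear in the second
   argument. *)
HB.mixin Record CompleteNormedModule_isHilbert (R : realType)
    (k : scalar_kind) H of CompleteNormedModule (scalar_field R k) H := {
  inner : {dot H for @scalar_conj R k};
  sqr_normE : forall x : H, `|x| ^+ 2 = inner x x
}.

#[short(type="hilbertType")]
HB.structure Definition Hilbert (R : realType) (k : scalar_kind) :=
  {H of CompleteNormedModule_isHilbert R k H &
        CompleteNormedModule (scalar_field R k) H}.

Section Hilbert.
Context {R : realType} {k : scalar_kind} {H : hilbertType R k}.
Local Notation K := (scalar_field R k).
Implicit Types (V W : set H) (T : H -> H) (x f : H).

Definition closed_subspace W : Prop :=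
  closed W /\ GRing.submod_closed (mem W).

Definition orthocompl W : set H := [set x | forall w, W w -> inner x w = 0].

(* When W is a closed subspace, the set below is a singleton. *)
Definition orth_proj W f : H := xget 0 [set p | W p /\ orthocompl W (f - p)].

Definition is_basis n W (e : 'I_n -> H) : Prop :=
  (forall i, W (e i)) /\
  (forall x, W x -> exists! c : 'rV[K]_n, x = \sum_i c 0 i *: e i).

Definition finite_dim W : Prop := exists n (e : 'I_n -> H), is_basis W e.

(* Meaningful for finite-dimensional subspaces only (else 0). *)
Definition subspace_dim W : nat :=
  xget 0%N [set n | exists e : 'I_n -> H, is_basis W e].

(* Trace of the matrix of T in any basis of H, for H finite-dimensional and
   T linear. *)
Definition op_trace T : K :=
  xget 0 [set t | exists n (e : 'I_n -> H) (M : 'M[K]_n),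
    [/\ is_basis setT e,
        forall j, T (e j) = \sum_i M i j *: e i & t = \tr M]].

Definition sqr_chordal_dist V W : K :=
  (subspace_dim (setT : set H))%:R - op_trace (orth_proj V \o orth_proj W).

Definition eigenpair T x (lambda : K) : Prop := x != 0 /\ T x = lambda *: x.

Definition eigenvector T x : Prop := exists lambda, eigenpair T x lambda.

End Hilbert.

(* Convergence along the net of finite subsets of I; the limit is
   [summability.sum]. *)
Definition sum_cvg (I : choiceType) (K : numDomainType) (V : normedModType K)
  (x : I -> V) : Prop := cvg (partial_sum x @ totally).

Section FusionFrame.
Context {R : realType} {k : scalar_kind} {H : hilbertType R k}.
Local Notation K := (scalar_field R k).
Context {I : choiceType}.
Implicit Types (W : I -> set H) (v : I -> K).

Definition fusion_frame W v : Prop :=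
  [/\ forall i, closed_subspace (W i),
      forall i, 0 < v i &
      exists A B : K, [/\ 0 < A, A <= B & forall f : H,
        let terms i : K^o := v i ^+ 2 * `|orth_proj (W i) f| ^+ 2 in
        sum_cvg terms /\ A * `|f| ^+ 2 <= summability.sum terms <= B * `|f| ^+ 2]].

Definition fusion_frame_operator W v : H -> H :=
  fun f => summability.sum (fun i => v i ^+ 2 *: orth_proj (W i) f).

Definition orthogonal_family W : I -> set H := fun i => orthocompl (W i).

End FusionFrame.

(* Main.v *)
(* In a Hilbert space the projection onto the orthogonal complement of W_i is
   1 - P_i.  By Pythagoras the two frame sums at f <> 0 add up to
   (sum_i v_i^2) |f|^2, so the squared weights are summable; hence both frame
   operators converge absolutely and their sum is (sum_i v_i^2) id, which gives
   (i).  For (ii), expand tr((1 - P)(1 - Q)) = n - tr P - tr Q + tr PQ and use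
   that the trace of an idempotent is its rank. *)

Require Import Defs.
From mathcomp Require Import all_boot all_order all_algebra sesquilinear.
From mathcomp Require Import finmap complex.
From mathcomp Require Import all_classical all_reals all_analysis.
From mathcomp Require Import summability ring.

Set Implicit Arguments.
Unset Strict Implicit.
Unset Printing Implicit Defensive.

Import Order.TTheory GRing.Theory Num.Theory.
Import numFieldNormedType.Exports.

Local Open Scope classical_set_scope.
Local Open Scope ring_scope.

(** * Scalars: conjugation and infima, uniformly over [R] and [R[i]] *)

Lemma scalar_mul_conj (R : realType) (k : scalar_kind) (a : scalar_field R k) :
  a * scalar_conj R k a = `|a| ^+ 2.
Proof.
case: k a => /= a; last by rewrite normCK.
by rewrite real_normK ?num_real // expr2.
Qed.

Lemma scalar_conj_ge0 (R : realType) (k : scalar_kind) (a : scalar_field R k) :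
  0 <= a -> scalar_conj R k a = a.
Proof. by case: k a => //= a /geC0_conj. Qed.

(** Nonnegative elements of [R[i]] are real, so the infimum of the real parts serves although the
    order on [R[i]] is partial. *)
Lemma scalar_infimum (R : realType) (k : scalar_kind)
    (E : set (scalar_field R k)) :
  E !=set0 -> (forall x, E x -> 0 <= x) ->
  exists d, (forall x, E x -> d <= x) /\
            forall e, 0 < e -> exists2 x, E x & x < d + e.
Proof.
case: k E => /= E [x0 Ex0] E_ge0.
  have infE : has_inf E by split; [exists x0 | exists 0 => x /E_ge0].
  exists (inf E); split => [x Ex|e e0]; first exact: ge_inf (infE.2) _ Ex.
  by have [x Ex xlt] := inf_adherent e0 infE; exists x.
have ReK (x : R[i]) : 0 <= x -> x = (complex.Re x)%:C%C.
  by case: x => a b; rewrite lecE /= => /andP[/eqP ->].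
have infE : has_inf (@complex.Re R @` E).
  split; first by exists (complex.Re x0), x0.
  by exists 0 => _ [x Ex <-]; move: (E_ge0 _ Ex); rewrite lecE => /andP[].
exists (inf (@complex.Re R @` E))%:C%C; split => [x Ex|e e0].
  by rewrite (ReK x) ?E_ge0 // lecR; apply: ge_inf (infE.2) _ _; exists x.
have Ee := ReK _ (ltW e0); have e0' : 0 < complex.Re e.
  by move: e0; rewrite {1}Ee ltcR.
have [_ [x Ex <-] xlt] := inf_adherent e0' infE; exists x => //.
by rewrite (ReK x) ?E_ge0 // Ee -rmorphD /= ltcR.
Qed.

(** * Orthogonal projection onto a closed subspace *)

Section Projection.
Context {R : realType} {k : scalar_kind} {H : hilbertType R k}.
Local Notation K := (scalar_field R k).
Implicit Types (W : set H) (x y w f p : H).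

Lemma inner_conj x y : inner x y = scalar_conj R k (inner y x).
Proof. by rewrite hermC expr0 mul1r. Qed.

Lemma inner0r x : inner x 0 = 0 :> K. Proof. exact: linear0r. Qed.
Lemma innerDl x y z : inner (x + y) z = inner x z + inner y z :> K.
Proof. exact: linearDl. Qed.
Lemma innerZl (a : K) x y : inner (a *: x) y = a * inner x y.
Proof. exact: linearZl_LR. Qed.
Lemma innerZr (a : K) x y : inner x (a *: y) = scalar_conj R k a * inner x y.
Proof. exact: linearZr_LR. Qed.

Lemma sqr_normD x y :
  `|x + y| ^+ 2 = `|x| ^+ 2 + `|y| ^+ 2 + (inner x y + scalar_conj R k (inner x y)).
Proof. by rewrite !sqr_normE hnormD expr0 mul1r. Qed.

Lemma sqr_normB x y :
  `|x - y| ^+ 2 = `|x| ^+ 2 + `|y| ^+ 2 - (inner x y + scalar_conj R k (inner x y)).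
Proof. by rewrite !sqr_normE hnormB expr0 mul1r. Qed.

Lemma parallelogram x y :
  `|x + y| ^+ 2 + `|x - y| ^+ 2 = 2 * (`|x| ^+ 2 + `|y| ^+ 2).
Proof. by rewrite sqr_normD sqr_normB addrACA subrr addr0 mulr_natl mulr2n. Qed.

Lemma closed_subspaceP W : closed_subspace W ->
  [/\ closed W, W 0 & forall (a : K) x y, W x -> W y -> W (a *: x + y)].
Proof.
move=> [clW [W0 WD]]; split=> //; first by move: W0; rewrite inE.
by move=> a x y Wx Wy; have := WD a x y; rewrite !inE; apply.
Qed.

(** Near-minimizers of the distance from [f] to [W] form a Cauchy filter; its limit attains the
    distance, and minimality forces orthogonality. Hence the default value in [orth_proj] never
    arises for closed subspaces. *)
Lemma projection_exists W f : closed_subspace W ->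
  exists p, W p /\ orthocompl W (f - p).
Proof.
case/closed_subspaceP=> clW W0 Wlin.
have W_D x y : W x -> W y -> W (x + y).
  by move=> Wx Wy; have := Wlin 1 x y Wx Wy; rewrite scale1r.
have W_Z (a : K) x : W x -> W (a *: x).
  by move=> Wx; have := Wlin a x 0 Wx W0; rewrite addr0.
have [|_ [x Wx <-]|d [dle dinf]] := @scalar_infimum R k [set `|f - w| ^+ 2 | w in W].
- by exists (`|f - 0| ^+ 2); exists 0.
- exact: exprn_ge0.
have {}dle w : W w -> d <= `|f - w| ^+ 2 by move=> Ww; apply: dle; exists w.
pose near_min (e : K) := [set w | W w /\ `|f - w| ^+ 2 < d + e].
(* The filter generated by the sets of near-minimizers replaces a minimizing sequence. *)
pose F : set_system H := filter_from [set e | 0 < e] near_min.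
have FF : ProperFilter F.
  apply: filter_from_proper; last first.
    by move=> e /= /dinf[_ [w Ww <-] wlt]; exists w.
  apply: filter_from_filter; first by exists 1 => /=.
  move=> a b /= a0 b0.
  (* Positive scalars are real, hence comparable, and the smaller tolerance gives the
     intersection. *)
  have [ab|/ltW ba] := real_leP (gtr0_real a0) (gtr0_real b0).
    exists a => // w [Ww wlt]; split; split => //.
    by apply: lt_le_trans wlt _; rewrite lerD2l.
  exists b => // w [Ww wlt]; split; split => //.
  by apply: lt_le_trans wlt _; rewrite lerD2l.
(* Parallelogram law at the midpoint of x and y, which lies in W. *)
have dist_lt e x y : near_min e x -> near_min e y -> `|x - y| ^+ 2 < 4 * e.
  move=> [Wx xlt] [Wy ylt].
  have := parallelogram (f - x) (f - y).
  have := dle (2^-1 *: (x + y)) (W_Z _ _ (W_D _ _ Wx Wy)).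
  have -> : f - x + (f - y) = 2 *: (f - 2^-1 *: (x + y)).
    rewrite scalerBr scalerA divff ?pnatr_eq0 // scale1r.
    by rewrite scaler_nat mulr2n opprD addrACA.
  have -> : f - x - (f - y) = y - x by rewrite opprB addrC addrA subrK.
  rewrite normrZ exprMn normr_nat (distrC y) => le1 E.
  have -> : `|x - y| ^+ 2 = 2 * (`|f - x| ^+ 2 + `|f - y| ^+ 2)
      - 2 ^+ 2 * `|f - 2^-1 *: (x + y)| ^+ 2.
    by rewrite -E addrAC subrr add0r.
  have -> : 4 * e = 2 * ((d + e) + (d + e)) - 2 ^+ 2 * d by ring.
  rewrite ltr_leB ?ler_pM2l ?exprn_gt0 //.
  by rewrite ltr_pM2l // ltrD.
have Fcvg : cvg F.
  apply/cauchy_cvgP/cauchy_exP => e e0.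
  (* This tolerance turns the bound [4 * e] of [dist_lt] into the square of the wanted radius. *)
  have h0 : 0 < e ^+ 2 / 4 by rewrite divr_gt0 ?exprn_gt0.
  have [_ [w Ww <-] wlt] := dinf _ h0.
  exists w; exists (e ^+ 2 / 4) => // z zmin.
  rewrite -ball_normE /=.
  rewrite -(@ltr_pXn2r _ 2) ?nnegrE ?normr_ge0 ?ltW //.
  have -> : e ^+ 2 = 4 * (e ^+ 2 / 4) by rewrite mulrCA divff ?mulr1 ?pnatr_eq0.
  exact: dist_lt.
set p := lim F; have Wp : W p.
  apply: (@closed_cvg _ _ F _ id W clW) => //.
  by exists 1 => //= w [].
exists p; split => //.
have p_min : `|f - p| ^+ 2 <= d.
  have cv : (fun w => `|f - w| ^+ 2 : K^o) @ F --> (`|f - p| ^+ 2 : K^o).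
    have cv1 : (fun w => `|f - w| : K^o) @ F --> (`|f - p| : K^o).
      by apply: cvg_norm; apply: cvgB => //; apply: cvg_cst.
    by rewrite expr2; under eq_fun do rewrite expr2; apply: cvgM.
  (* If the gap [g] were positive, some [w] would have squared distance both below [d + g / 2] and
     within [g / 2] of that of [p], giving [|f - p|^2 < d + g], which is absurd. *)
  have := dle _ Wp; rewrite le_eqVlt => /predU1P[<- //|]; rewrite -subr_gt0.
  set g := _ - d => g0.
  have g2 : 0 < g / 2 by rewrite divr_gt0.
  have /cvgrPdist_lt/(_ _ g2) close := cv.
  have : F (near_min (g / 2)) by exists (g / 2).
  move=> /filterI/(_ close)/filter_ex[w [[Ww wlt] /= wclose]].
  have dlt : `|f - p| ^+ 2 - `|f - w| ^+ 2 < g / 2.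
    apply: le_lt_trans wclose; apply: real_ler_norm.
    by rewrite rpredB // ger0_real // exprn_ge0.
  have := ltrD dlt wlt.
  by rewrite subrK addrCA -splitr /g [d + _]addrC subrK ltxx.
move=> w Ww; have [->|w0] := eqVneq w 0; first exact: inner0r.
have n0 : 0 < `|w| ^+ 2 :> K by rewrite exprn_gt0 ?normr_gt0.
(* Moving [p] by [(s * a) *: w], the component of [f - p] along [w], lowers the squared distance by
   [s * |a|^2]; minimality then gives [a = 0]. *)
set a := inner (f - p) w; set s := (`|w| ^+ 2)^-1.
have s0 : 0 < s by rewrite invr_gt0.
have : `|f - p| ^+ 2 <= `|f - (p + (s * a) *: w)| ^+ 2.
  by apply: le_trans p_min _; apply: dle; apply: W_D => //; apply: W_Z.
have inner_sa : inner (f - p) ((s * a) *: w) = s * `|a| ^+ 2.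
  rewrite innerZr -/a rmorphM (scalar_conj_ge0 (ltW s0)).
  by rewrite -mulrA [_ * a]mulrC scalar_mul_conj.
rewrite opprD addrA (sqr_normB (f - p)) inner_sa scalar_conj_ge0; last first.
  by rewrite mulr_ge0 ?exprn_ge0 // ltW.
rewrite normrZ exprMn normrM (gtr0_norm s0).
have -> : (s * `|a|) ^+ 2 * `|w| ^+ 2 = s * `|a| ^+ 2.
  by rewrite exprMn [s ^+ 2]expr2 mulrAC -[s * s * _]mulrA mulVf ?mulr1 ?lt0r_neq0.
rewrite -addrA lerDl opprD addrA subrr add0r oppr_ge0 pmulr_rle0 // => h.
by apply/eqP; rewrite -normr_eq0 -sqrf_eq0 eq_le h exprn_ge0.
Qed.

Lemma orthocompl_linear W (a : K) x y :
  orthocompl W x -> orthocompl W y -> orthocompl W (a *: x + y).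
Proof. by move=> Wx Wy w Ww; rewrite innerDl innerZl Wx // Wy // mulr0 addr0. Qed.

Lemma orthocompl_disjoint W x : W x -> orthocompl W x -> x = 0.
Proof.
by move=> Wx /(_ _ Wx)/eqP; rewrite -sqr_normE sqrf_eq0 normr_eq0 => /eqP.
Qed.

Lemma orth_projP W f : closed_subspace W ->
  W (orth_proj W f) /\ orthocompl W (f - orth_proj W f).
Proof.
move=> /(projection_exists f)[p Wp]; rewrite /orth_proj.
by case: xgetP => [_ _ []//|/(_ p)].
Qed.

(** The difference of two candidates lies in both [W] and its orthogonal complement, so it
    vanishes. *)
Lemma orth_proj_eq W f p : closed_subspace W ->
  W p -> orthocompl W (f - p) -> orth_proj W f = p.
Proof.
move=> cW Wp Wfp; have [Wq Wfq] := orth_projP f cW.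
have [_ _ Wlin] := closed_subspaceP cW.
apply/eqP; rewrite -subr_eq0; apply/eqP/(@orthocompl_disjoint W).
  by rewrite addrC -scaleN1r; exact: Wlin.
rewrite (_ : _ - p = (-1) *: (f - orth_proj W f) + (f - p)).
  exact: orthocompl_linear.
by rewrite scaleN1r opprB addrA subrK.
Qed.

Lemma orth_proj_orthocompl W f :
  closed_subspace W -> closed_subspace (orthocompl W) ->
  orth_proj (orthocompl W) f = f - orth_proj W f.
Proof.
move=> cW cWp; have [Wp Wfp] := orth_projP f cW.
apply: orth_proj_eq => // x Wx.
by rewrite opprB addrC subrK inner_conj Wx // rmorph0.
Qed.

Lemma pythagoras W f : closed_subspace W ->
  `|f| ^+ 2 = `|orth_proj W f| ^+ 2 + `|f - orth_proj W f| ^+ 2.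
Proof.
move=> cW; have [Wp Wfp] := orth_projP f cW.
have := sqr_normD (f - orth_proj W f) (orth_proj W f).
by rewrite subrK Wfp // rmorph0 !addr0 => ->; rewrite addrC.
Qed.
End Projection.

(** * Unordered sums along the net of finite subsets *)

Section Summation.
#[local] Existing Instance totally_filter.
Context {I : choiceType} {K : numFieldType}.

Lemma partial_sumE (V : zmodType) (x : I -> V) (A : {fset I}) :
  partial_sum x A = \sum_(i <- A) x i.
Proof. by rewrite /partial_sum big_seq_fsetE. Qed.

Lemma partial_sumB (V : zmodType) (x : I -> V) (A B : {fset I}) :
  (A `<=` B)%fset -> partial_sum x B - partial_sum x A = \sum_(i <- (B `\` A)%fset) x i.
Proof.
move=> AB; rewrite !partial_sumE (big_fsetID _ [in A]) /=.
rewrite (_ : [fset i in B | i \in A]%fset = A); last first.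
  by apply/fsetP => i; rewrite !inE andb_idl // => /(fsubsetP AB).
rewrite addrAC subrr add0r; congr (\sum_(i <- enum_fset _) _).
by apply/fsetP => i; rewrite !inE andbC.
Qed.

(** Cauchy criterion: over the finite set [B] minus [A], the sum of [x] is bounded in norm by that
    of [a], which is small once [A] is large. *)
Lemma sum_cvg_dominated (V : completeNormedModType K) (a : I -> K^o) (x : I -> V) :
  (forall i, `|x i| <= a i) -> sum_cvg a -> sum_cvg x.
Proof.
move=> xa /cvg_ex[l /cvgrPdist_lt al].
apply/cauchy_cvgP/cauchy_exP => e e0.
have e20 : 0 < e / 2 by rewrite divr_gt0.
have [A _ Al] := al _ e20.
exists (partial_sum x A); exists A => // B /= AB.
rewrite -ball_normE /= distrC partial_sumB //.
apply: le_lt_trans (ler_norm_sum _ _ _) _.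
apply: (@le_lt_trans _ _ (partial_sum a B - partial_sum a A)).
  by rewrite partial_sumB //; apply: ler_sum.
have ge0 : 0 <= partial_sum a B - partial_sum a A.
  by rewrite partial_sumB //; apply: sumr_ge0 => i _; apply: le_trans (xa i).
(* Comparing with the limit [l] splits the increment into the errors at [B] and at [A], each below
   [e / 2]. *)
rewrite -(ger0_norm ge0) -(subrKA l) (splitr e).
apply: le_lt_trans (ler_normD _ _) _.
by apply: ltrD; [rewrite distrC; exact: Al | apply: Al; exact: fsubset_refl].
Qed.

Context {V : normedModType K}.
Implicit Types (x y : I -> V).

Lemma sum_cvgD x y : sum_cvg x -> sum_cvg y -> sum_cvg (fun i => x i + y i).
Proof.
move=> cx cy; rewrite /sum_cvg (_ : partial_sum _ = partial_sum x \+ partial_sum y).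
  exact: is_cvgD.
by apply/funext => A; rewrite /partial_sum big_split.
Qed.

Lemma sumD x y : sum_cvg x -> sum_cvg y ->
  summability.sum (fun i => x i + y i) = summability.sum x + summability.sum y.
Proof.
move=> cx cy; rewrite /summability.sum (_ : partial_sum _ = partial_sum x \+ partial_sum y).
  by apply: cvg_lim => //; apply: cvgD.
by apply/funext => A; rewrite /partial_sum big_split.
Qed.

Lemma sum_cvgZ (a : I -> K^o) (z : V) : sum_cvg a -> sum_cvg (fun i => a i *: z).
Proof.
move=> ca; rewrite /sum_cvg (_ : partial_sum _ = fun A => partial_sum a A *: z).
  exact: is_cvgZr_tmp.
by apply/funext => A; rewrite /partial_sum scaler_suml.
Qed.

Lemma sumZ (a : I -> K^o) (z : V) : sum_cvg a ->
  summability.sum (fun i => a i *: z) = summability.sum a *: z.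
Proof.
move=> ca; rewrite /summability.sum (_ : partial_sum _ = fun A => partial_sum a A *: z).
  by apply: cvg_lim => //; apply: cvgZr_tmp.
by apply/funext => A; rewrite /partial_sum scaler_suml.
Qed.
End Summation.

(** * Summability of the squared weights and the sum of the two frame operators *)

Section OrthogonalFusionFrame.
Context {R : realType} {k : scalar_kind} {H : hilbertType R k} {I : choiceType}.
Local Notation K := (scalar_field R k).
Context (W : I -> set H) (v : I -> K).
Hypothesis frameW : fusion_frame W v.
Hypothesis frameWperp : fusion_frame (orthogonal_family W) v.

Let closedW i : closed_subspace (W i).
Proof. by case: frameW. Qed.

Let closedWperp i : closed_subspace (orthocompl (W i)).
Proof. by case: frameWperp => /(_ i). Qed.

Let v_ge0 i : 0 <= v i ^+ 2.
Proof. by case: frameW => _ /(_ i)/ltW v0 _; exact: exprn_ge0. Qed.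

(** The combined frame sums at [f] are divided by [|f|^2], hence [f != 0]: on the zero space the
    frame bounds say nothing about the weights. *)
Lemma weights_sum_cvg (f : H) : f != 0 -> sum_cvg (fun i => v i ^+ 2 : K^o).
Proof.
move=> f0; have n0 : `|f| ^+ 2 != 0 by rewrite sqrf_eq0 normr_eq0.
case: frameW => _ _ [A [B [_ _ /(_ f) [c1 _]]]].
case: frameWperp => _ _ [A' [B' [_ _ /(_ f) [c2 _]]]].
have := sum_cvgZ (z := (`|f| ^+ 2)^-1 : K^o) (sum_cvgD c1 c2).
congr sum_cvg; apply/funext => i /=.
rewrite /orthogonal_family orth_proj_orthocompl // -mulrDr -pythagoras //.
by rewrite -[_ *: _]mulrA divff ?mulr1.
Qed.

Lemma frame_operator_add (f : H) : f != 0 ->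
  fusion_frame_operator W v f + fusion_frame_operator (orthogonal_family W) v f =
  summability.sum (fun i => v i ^+ 2 : K^o) *: f.
Proof.
move=> /[dup] f0 /weights_sum_cvg cv.
(* A summable majorant for both operator sums, since each projection and its complement are
   contractions by Pythagoras. *)
have dom : sum_cvg (fun i => v i ^+ 2 * `|f| : K^o)
  by exact: (sum_cvgZ (z := `|f| : K^o) cv).
have le_f i : `|orth_proj (W i) f| <= `|f| /\ `|f - orth_proj (W i) f| <= `|f|.
  by split; rewrite -(@ler_pXn2r _ 2) ?nnegrE // (pythagoras f (closedW i))
    ?lerDl ?lerDr exprn_ge0.
rewrite -sumZ // /fusion_frame_operator -sumD.
- congr summability.sum; apply/funext => i.
  by rewrite /orthogonal_family orth_proj_orthocompl // -scalerDr addrC subrK.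
- apply: sum_cvg_dominated dom => i.
  by rewrite normrZ (ger0_norm (v_ge0 i)) ler_wpM2l //; case: (le_f i).
- apply: sum_cvg_dominated dom => i; rewrite /orthogonal_family orth_proj_orthocompl //.
  by rewrite normrZ (ger0_norm (v_ge0 i)) ler_wpM2l //; case: (le_f i).
Qed.
End OrthogonalFusionFrame.

(** * Finite-dimensional linear algebra: coordinates, dimension and trace *)

Lemma mxtrace_idempotent (F : fieldType) n (N : 'M[F]_n) :
  N *m N = N -> \tr N = (\rank N)%:R.
Proof.
move=> NN; rewrite -{1}(mulmx_base N) mxtrace_mulC.
suff -> : row_base N *m col_base N = 1%:M by rewrite mxtrace1.
have [C CN] := row_freeP (row_base_free N).
have [D DN] := row_fullP (col_base_full N).
have cancel r (L : 'M[F]_(n, r)) (U : 'M[F]_(r, n)) (A : 'M[F]_(n, r))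
    (B : 'M[F]_(r, n)) :
    U *m A = 1%:M -> B *m L = 1%:M -> L *m U *m (L *m U) = L *m U ->
    U *m L = 1%:M.
  move=> UC DL /(congr1 (fun X => B *m X *m A)).
  by rewrite !mulmxA DL mul1mx -!mulmxA UC mulmx1.
by apply: (cancel _ _ _ C D) => //; rewrite mulmx_base.
Qed.

Section Trace.
Context {R : realType} {k : scalar_kind} {H : hilbertType R k}.
Local Notation K := (scalar_field R k).
Implicit Types (W : set H).

Definition lincomb n (e : 'I_n -> H) (c : 'rV[K]_n) : H := \sum_i c 0 i *: e i.

Lemma lincomb_delta n (e : 'I_n -> H) i : lincomb e (delta_mx 0 i) = e i.
Proof.
rewrite /lincomb (bigD1 i) //= mxE !eqxx scale1r big1 ?addr0 // => j /negPf ji.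
by rewrite mxE ji andbF scale0r.
Qed.

Lemma lincombB n (e : 'I_n -> H) c c' :
  lincomb e (c - c') = lincomb e c - lincomb e c'.
Proof.
by rewrite /lincomb -sumrB; apply: eq_bigr => i _; rewrite !mxE scalerBl.
Qed.

Lemma lincomb_mul n m (e : 'I_n -> H) (e' : 'I_m -> H) (A : 'M[K]_(m, n)) c :
  (forall j, e' j = lincomb e (row j A)) -> lincomb e' c = lincomb e (c *m A).
Proof.
move=> e'E; rewrite /lincomb; under eq_bigr do rewrite e'E scaler_sumr.
rewrite exchange_big /=; apply: eq_bigr => i _.
rewrite mxE scaler_suml; apply: eq_bigr => j _.
by rewrite scalerA mxE.
Qed.

Lemma lincomb_closed W n (e : 'I_n -> H) c :
  W 0 -> (forall (a : K) x y, W x -> W y -> W (a *: x + y)) ->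
  (forall i, W (e i)) -> W (lincomb e c).
Proof.
move=> W0 Wlin We; rewrite /lincomb; elim/big_rec: _ => // i x _ Wx; exact: Wlin.
Qed.

(** [is_basis] asserts uniqueness of coordinates only for vectors of [W]; the closure hypotheses
    place [lincomb e c] there. *)
Lemma basis_inj n W (e : 'I_n -> H) : is_basis W e -> W 0 ->
  (forall (a : K) x y, W x -> W y -> W (a *: x + y)) -> injective (lincomb e).
Proof.
move=> [We eW] W0 Wlin c c' cc'.
have [d [_ duniq]] := eW _ (lincomb_closed c W0 Wlin We).
by rewrite -(duniq c) // -(duniq c').
Qed.

Lemma basis_coordinates n m W (e : 'I_n -> H) (x : 'I_m -> H) : is_basis W e ->
  (forall j, W (x j)) -> exists A : 'M[K]_(m, n), forall j, x j = lincomb e (row j A).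
Proof.
move=> [_ eW] Wx.
have /choice[c cP] : forall j, exists c : 'rV[K]_n, x j = lincomb e c.
  by move=> j; have [c [xE _]] := eW _ (Wx j); exists c.
by exists (\matrix_j c j) => j; rewrite rowK.
Qed.

(** Each basis is expanded in the other, and uniqueness of coordinates makes the two matrices
    inverse. They are rectangular, as [m = n] is not yet known. *)
Lemma basis_change n m W (e : 'I_n -> H) (e' : 'I_m -> H) :
  W 0 -> (forall (a : K) x y, W x -> W y -> W (a *: x + y)) ->
  is_basis W e -> is_basis W e' ->
  exists (A : 'M[K]_(m, n)) (B : 'M[K]_(n, m)),
    [/\ forall j, e' j = lincomb e (row j A), A *m B = 1%:M & B *m A = 1%:M].
Proof.
move=> W0 Wlin be be'.
have [A AP] := basis_coordinates be (be'.1); have [B BP] := basis_coordinates be' (be.1).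
exists A, B; split => //; apply/row_matrixP => i; rewrite row_mul row1.
  apply: (basis_inj be' W0 Wlin).
  by rewrite -(lincomb_mul _ BP) -AP lincomb_delta.
apply: (basis_inj be W0 Wlin).
by rewrite -(lincomb_mul _ AP) -BP lincomb_delta.
Qed.

(** Mutually inverse rectangular matrices are square, so every basis [xget] could select has size
    [n]. *)
Lemma subspace_dim_eq n W (e : 'I_n -> H) :
  W 0 -> (forall (a : K) x y, W x -> W y -> W (a *: x + y)) ->
  is_basis W e -> subspace_dim W = n.
Proof.
move=> W0 Wlin be; rewrite /subspace_dim.
case: xgetP => [m _ [e' be']|/(_ n)]; last first.
  by move=> /=; case; exists e.
have [A [B [_ AB BA]]] := basis_change W0 Wlin be be'.
by apply/eqP; rewrite eqn_leq (mulmx1_min AB) (mulmx1_min BA).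
Qed.

(** Basis independence of the trace: the matrix behind [op_trace] is similar to [N] up to
    transposition, because [op_trace] uses columns and [N] acts on rows. *)
Lemma op_trace_eq n (e : 'I_n -> H) (T : H -> H) (N : 'M[K]_n) :
  is_basis setT e -> (forall c, T (lincomb e c) = lincomb e (c *m N)) ->
  op_trace T = \tr N.
Proof.
move=> be TN; rewrite /op_trace; case: xgetP => [t _|/(_ (\tr N))]; last first.
  case; exists n, e, N^T; split; rewrite ?mxtrace_tr // => j.
  rewrite -{1}(lincomb_delta e j) TN -rowE /lincomb.
  by apply: eq_bigr => i _; rewrite !mxE.
move=> [m [e' [M [be' TM ->]]]].
have [A [B [e'E AB BA]]] := basis_change (W := setT) I (fun _ _ _ _ _ => I) be be'.
suff MA : M^T *m A = A *m N.
  rewrite -mxtrace_tr -[M^T]mulmx1 -AB mulmxA MA -mulmxA mxtrace_mulC -mulmxA.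
  by rewrite BA mulmx1.
apply/row_matrixP => j; apply: (basis_inj be) => //.
rewrite row_mul -(lincomb_mul _ e'E) row_mul -TN -e'E TM /lincomb.
by apply: eq_bigr => i _; rewrite !mxE.
Qed.

(* The matrix acts on rows of coordinates, so composition reverses products. *)
Lemma orth_proj_matrix W n (e : 'I_n -> H) :
  closed_subspace W -> is_basis setT e ->
  exists N : 'M[K]_n,
    (forall c, orth_proj W (lincomb e c) = lincomb e (c *m N)) /\
    \tr N = (subspace_dim W)%:R.
Proof.
move=> cW be; have [_ W0 Wlin] := closed_subspaceP cW.
have [N NE] := basis_coordinates (x := fun j => orth_proj W (e j)) be (fun _ => I).
have WN c : W (lincomb e (c *m N)).
  rewrite -(lincomb_mul _ NE); apply: lincomb_closed => // i.
  by have [] := orth_projP (e i) cW.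
(* Linearity of the projection: the residual is a combination of the vectors
   [e i - orth_proj W (e i)], all orthogonal to [W]. *)
have PN c : orth_proj W (lincomb e c) = lincomb e (c *m N).
  apply: orth_proj_eq => //; rewrite -(lincomb_mul _ NE) /lincomb -sumrB.
  under eq_bigr do rewrite -scalerBr.
  apply: (lincomb_closed (W := orthocompl W)
    (e := fun i => e i - orth_proj W (e i))).
  - by move=> w _; rewrite linear0l.
  - by move=> a x y; exact: orthocompl_linear.
  - by move=> i; have [] := orth_projP (e i) cW.
have e_inj := basis_inj be I (fun _ _ _ _ _ => I).
have Pid x : W x -> orth_proj W x = x.
  by move=> Wx; apply: orth_proj_eq => //; rewrite subrr => w _; rewrite linear0l.
(* The rows of [N] are coordinates of vectors of [W], which the projection fixes. *)
have NN : N *m N = N.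
  by apply/row_matrixP => i; rewrite row_mul; apply: e_inj; rewrite -PN Pid // rowE.
exists N; split=> //; rewrite mxtrace_idempotent //; congr _%:R; apply/esym.
(* The row space of [N] is the space of coordinates of vectors of [W], so a row basis of [N] yields
   a basis of [W] with [\rank N] elements. *)
pose b i := lincomb e (row i (row_base N)).
have bE c : lincomb b c = lincomb e (c *m row_base N) by apply: lincomb_mul.
apply: (subspace_dim_eq (e := b)) => //; split.
  move=> i; rewrite /b; have /submxP[D ->] : (row i (row_base N) <= N)%MS.
    by rewrite (submx_trans (row_sub _ _)) // eq_row_base.
  exact: WN.
move=> x Wx; have [c [xE _]] := be.2 x I.
(* A vector of [W] is its own projection, so its coordinates lie in the row space of [N]. *)
have cN : c *m N = c by apply: e_inj; rewrite -PN -[lincomb e c]xE Pid.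
have /submxP[D cD] : (c <= row_base N)%MS by rewrite eq_row_base -cN submxMl.
exists D; split; first by rewrite -/(lincomb b D) bE -cD.
move=> D' xE'; have {xE'} : x = lincomb b D' by [].
rewrite bE xE => /e_inj; rewrite cD => /row_free_injr; apply.
exact: row_base_free.
Qed.

Lemma sqr_chordal_dist_orthocompl V W :
  finite_dim [set: H] -> closed_subspace V -> closed_subspace W ->
  closed_subspace (orthocompl V) -> closed_subspace (orthocompl W) ->
  sqr_chordal_dist (orthocompl V) (orthocompl W) =
  sqr_chordal_dist V W + (subspace_dim V)%:R + (subspace_dim W)%:R
    - (subspace_dim [set: H])%:R.
Proof.
move=> [n [e be]] cV cW cVp cWp; rewrite /sqr_chordal_dist.
have [N [NE <-]] := orth_proj_matrix cV be.
have [M [ME <-]] := orth_proj_matrix cW be.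
rewrite (subspace_dim_eq _ _ be) //.
rewrite (op_trace_eq (T := orth_proj V \o orth_proj W) (N := M *m N) be); last first.
  by move=> c /=; rewrite ME NE mulmxA.
(* The complementary projections have matrices [1 - N] and [1 - M]. *)
rewrite (op_trace_eq (N := (1%:M - M) *m (1%:M - N)) be); last first.
  move=> c /=; rewrite !orth_proj_orthocompl // ME -lincombB NE -lincombB.
  by rewrite mulmxA !mulmxBr !mulmx1.
rewrite mulmxBr mulmx1 mulmxBl mul1mx !raddfB /= mxtrace1.
by ring.
Qed.
End Trace.

(** * Shared eigenvectors and the chordal distance identity *)

Theorem theorem3p3 (R : realType) (k : scalar_kind) (H : hilbertType R k)
    (I : choiceType) (W : I -> set H) (v : I -> scalar_field R k)
    (hW : fusion_frame W v)
    (hWperp : fusion_frame (orthogonal_family W) v) :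
  let S := fusion_frame_operator W v in
  let Sperp := fusion_frame_operator (orthogonal_family W) v in
  let sqr_weights : I -> (scalar_field R k)^o := fun i => v i ^+ 2 in
  ((forall (J : Type) (e : J -> H) (lambda : J -> scalar_field R k),
      (forall j, eigenpair S (e j) (lambda j)) ->
      forall j, sum_cvg sqr_weights /\
        eigenpair Sperp (e j) (summability.sum sqr_weights - lambda j)) /\
   (forall x, eigenvector Sperp x <-> eigenvector S x)) /\
  (finite_dim [set: H] ->
   forall m : nat, (forall i, subspace_dim (W i) = m) ->
   forall i j, i != j ->
     sqr_chordal_dist (orthocompl (W i)) (orthocompl (W j)) =
     sqr_chordal_dist (W i) (W j) + 2 * m%:R - (subspace_dim [set: H])%:R).
Proof.
move=> S Sperp sqr_weights.
have closedW i : closed_subspace (W i) by case: hW.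
have closedWperp i : closed_subspace (orthocompl (W i)) by case: hWperp => /(_ i).
(* Restricting to nonzero vectors suffices, since eigenvectors are nonzero. *)
have SperpE f : f != 0 -> Sperp f = summability.sum sqr_weights *: f - S f.
  by move=> f0; rewrite -(frame_operator_add hW hWperp f0) addrC addKr.
have SE f : f != 0 -> S f = summability.sum sqr_weights *: f - Sperp f.
  by move=> f0; rewrite SperpE // subKr.
split; [split|].
- move=> J e lambda Se j; have [ej0 Sej] := Se j.
  split; first exact: weights_sum_cvg hW hWperp _ ej0.
  by split=> //; rewrite SperpE // Sej scalerBl.
(* Subtraction from the weight sum is an involution on eigenvalues, so one witness serves both
   directions. *)
- move=> x; split=> -[l [x0 xl]]; exists (summability.sum sqr_weights - l); split=> //.
    by rewrite SE // xl scalerBl.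
  by rewrite SperpE // xl scalerBl.
- move=> fd m dimW i j _; rewrite sqr_chordal_dist_orthocompl //.
  by rewrite !dimW mulr_natl mulr2n !addrA.
Qed.
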